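(* Let $f:\mathbb{R}^n\to\mathbb{R}$ be twice continuously differentiable, let $x^*$ satisfy $\nabla f(x^* )=0$, and suppose that the Hessian $H=H(x^* )$ of $f$ at $x^*$ is positive semidefinite, with largest eigenvalue $L$ and smallest nonzero eigenvalue $\ell$, where $L>\ell>0$; put $\bar\kappa=L/\ell$. For $\alpha>0$ let $q(x)=x-\alpha\nabla f(x)$, so that $q'(x^* )=I-\alpha H$, and for $\beta\in\mathbb{R}$ let $$T_N(x^*;\beta)=\begin{bmatrix}(1+\beta)q'(x^* )&-\beta I\\ I&0\end{bmatrix}$$ be the Jacobian matrix at $(x^*,x^* )$ of the iteration $x_{k+1}=(1+\beta)q(x_k)-\beta x_{k-1}$ written as a first-order system. Then the optimal asymptotic convergence factor of this iteration is $$\min_{\alpha>0,\ \beta\in\mathbb{R}}\rho\big(T_N(x^*;\beta)\big)=\frac{\sqrt{\bar\kappa}-1}{\sqrt{\bar\kappa}+1}<1-\sqrt{\frac{4\ell}{3L+\ell}},$$ where the unique optimal $\alpha$ and $\beta$ are given by $$\alpha_N^*=\frac{2}{L+\ell},\qquad \beta_N^*=\frac{1-\sqrt{1-\rho_{q'}^2}}{1+\sqrt{1-\rho_{q'}^2}}=\Big(\frac{\sqrt{\bar\kappa}-1}{\sqrt{\bar\kappa}+1}\Big)^2,\quad\text{where }\rho_{q'}=\frac{L-\ell}{L+\ell}.$$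
   Context: The iteration $x_{k+1}=(1+\beta)q(x_k)-\beta x_{k-1}$ is the reduced stationary nonlinear GMRES method with window size one (sNGMRES-R(1)) applied to steepest descent. The system form is $(x_k,x_{k-1})\mapsto((1+\beta)q(x_k)-\beta x_{k-1},\,x_k)$, and its asymptotic convergence factor at $x^*$ is $\rho(T_N(x^*;\beta))$, which depends on both $\alpha$ (through $q'$) and $\beta$. Convention for $\rho$: if $H$ is positive definite, $\rho(T_N)$ is the usual spectral radius. If $H$ has a kernel of dimension $d>0$, then $T_N(x^*;\beta)$ has the eigenvalue $1$ as a consequence, and $\rho(T_N)$ denotes the largest modulus of the eigenvalues that remain after removing from the list of eigenvalues (counted with algebraic multiplicity) the $d$ copies of the eigenvalue $1$ that come from the kernel of $H$. *)

(* Defs.v *)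
From HB Require Import structures.
From mathcomp Require Import all_boot all_order all_algebra.
From mathcomp Require Import all_classical all_reals all_analysis.
From mathcomp Require Import complex.

Set Implicit Arguments.
Unset Strict Implicit.
Unset Printing Implicit Defensive.

Import Order.TTheory GRing.Theory Num.Theory.
Import numFieldNormedType.Exports.

Local Open Scope classical_set_scope.
Local Open Scope ring_scope.

Section Calculus.
Variable R : realType.

(* Points of R^n are row vectors, and [jacobian] acts on them on the right.
   Transposing gives the usual convention: [jac g x] has entries
   (i, j) |-> d g_i / d x_j. *)
Definition jac n m (g : 'rV[R]_n -> 'rV[R]_m) (x : 'rV[R]_n) : 'M[R]_(m, n) :=
  (jacobian g x)^T.

Definition grad n (f : 'rV[R]_n -> R) (x : 'rV[R]_n) : 'rV[R]_n :=
  \row_(j < n) 'D_(delta_mx 0 j) f x.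

Definition hessian n (f : 'rV[R]_n -> R) (x : 'rV[R]_n) : 'M[R]_n :=
  \matrix_(i < n, j < n)
    'D_(delta_mx 0 i) (fun y : 'rV[R]_n => 'D_(delta_mx 0 j) f y) x.

Definition twice_continuously_differentiable n (f : 'rV[R]_n -> R) : Prop :=
  [/\ forall x, differentiable f x,
      forall x, differentiable (grad f) x &
      continuous (hessian f)].

End Calculus.

Section Spectrum.
Variable R : realType.

Definition psd n (A : 'M[R]_n) : Prop :=
  A^T = A /\ forall v : 'rV[R]_n, 0 <= (v *m A *m v^T) 0 0.

Definition largest_eigenvalue n (A : 'M[R]_n) (a : R) : Prop :=
  eigenvalue A a /\ forall b, eigenvalue A b -> b <= a.

Definition smallest_nonzero_eigenvalue n (A : 'M[R]_n) (a : R) : Prop :=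
  [/\ eigenvalue A a, a != 0 &
      forall b, eigenvalue A b -> b != 0 -> a <= b].

(* The complex eigenvalues of a real matrix, each repeated according to its
   algebraic multiplicity; the order of the list is irrelevant below. *)
Definition eigenvalues m (A : 'M[R]_m) : seq R[i] :=
  sval (closed_field_poly_normal (char_poly (map_mx (real_complex R) A))).

(* Largest modulus of the eigenvalues left after deleting d copies of 1 from
   the list; for d = 0 this is the usual spectral radius. *)
Definition spectral_radius_without_ones (d : nat) m (A : 'M[R]_m) : R :=
  \big[Num.max/0]_(z <- iter d (rem 1) (eigenvalues A))
     ComplexField.Normc.normc z.

End Spectrum.

Section Iteration.
Variables (R : realType) (n : nat) (f : 'rV[R]_n -> R).

Definition sd_map (alpha : R) (x : 'rV[R]_n) : 'rV[R]_n :=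
  x - alpha *: grad f x.

(* The pair (x_k, x_{k-1}) is encoded as the row [row_mx x_k x_{k-1}]. *)
Definition system_map (alpha beta : R) (z : 'rV[R]_(n + n)) : 'rV[R]_(n + n) :=
  row_mx ((1 + beta) *: sd_map alpha (lsubmx z) - beta *: rsubmx z) (lsubmx z).

Definition TN (x : 'rV[R]_n) (alpha beta : R) : 'M[R]_(n + n) :=
  block_mx ((1 + beta) *: jac (sd_map alpha) x) (- beta%:M)
           1%:M                                 0.

(* The number of discarded eigenvalues 1 is the dimension of the kernel of the
   Hessian, for every alpha and beta. *)
Definition rhoN (x : 'rV[R]_n) (alpha beta : R) : R :=
  spectral_radius_without_ones (\rank (kermx (hessian f x))) (TN x alpha beta).

End Iteration.

(* Main.v *)
Require Import Defs.
From mathcomp Require Import all_boot all_order all_algebra.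
From mathcomp Require Import all_classical all_reals all_analysis.
From mathcomp Require Import complex ring lra.
Import Order.TTheory GRing.Theory Num.Theory.
Import numFieldNormedType.Exports.
Local Open Scope ring_scope.

(* Diagonalising the symmetric Hessian splits the characteristic polynomial of
   T_N into the quadratics z^2 - (1 + b) (1 - a mu) z + b, one for each
   eigenvalue mu of H; mu = 0 gives the roots 1 (discarded) and b.  If both
   roots have modulus at most r, then |b| <= r^2 and
   |1 + b| |1 - a mu| r <= r^2 + b.  For r < 1, combining the second inequality
   at mu = l and mu = L with b <= r^2 gives (L - l)/(L + l) <= 2r/(1 + r^2),
   which is an equality exactly at the claimed rate, and then forces b = r^2
   and a = 2/(L + l).  Conversely, at these parameters all the quadratics with
   mu in [l, L] have nonpositive discriminant, so their roots have modulus
   sqrt b = r. *)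

(** * Scalar inequalities and moduli of the roots of real quadratics *)

Lemma optimal_parameters_unique (R : rcfType) (l L r a b : R) :
  0 < l -> l < L -> 0 < r -> r < 1 ->
  2 * r * (L + l) = (1 + r ^+ 2) * (L - l) ->
  `|b| <= r ^+ 2 ->
  `|(1 + b) * (1 - a * l)| * r <= r ^+ 2 + b ->
  `|(1 + b) * (1 - a * L)| * r <= r ^+ 2 + b ->
  a = 2 / (L + l) /\ b = r ^+ 2.
Proof.
move=> l0 lL r0 r1 hr; rewrite ler_norml => /andP[hb1 hb2] hl hL.
have r21 : r ^+ 2 < 1 by rewrite expr_lt1 // ltW.
have b1 : 0 < 1 + b by lra.
have h1 : (1 + b) * (1 - a * l) * r <= r ^+ 2 + b.
  by apply: le_trans hl; rewrite ler_pM2r // ler_norm.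
have h2 : (1 + b) * (a * L - 1) * r <= r ^+ 2 + b.
  by apply: le_trans hL; rewrite ler_pM2r // -normrN (le_trans _ (ler_norm _)) //; lra.
have hb : b = r ^+ 2.
  (* Weighting [h1] by [L] and [h2] by [l] cancels [a], since L(1 - al) + l(aL - 1) = L - l. *)
  have e1 : (1 + b) * r * (L - l) <= (r ^+ 2 + b) * (L + l) by nra.
  have e2 : (1 + b) * r * (L - l) * (1 + r ^+ 2) <=
            (r ^+ 2 + b) * (L + l) * (1 + r ^+ 2) by rewrite ler_wpM2r //; nra.
  have e3 : (1 + b) * r * (2 * r) * (L + l) <=
            (r ^+ 2 + b) * (1 + r ^+ 2) * (L + l).
    by rewrite -[_ * (2 * r) * _]mulrA hr; lra.
  rewrite ler_pM2r in e3; last lra.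
  (* Once [L + l] is cancelled, the difference of the two sides of [e3] factors this way; with r < 1
     it gives b >= r^2. *)
  have e4 : (1 - r ^+ 2) * (r ^+ 2 - b) <= 0 by lra.
  rewrite pmulr_rle0 in e4; last lra.
  lra.
split => //.
have r2 : 0 < 1 + r ^+ 2 by lra.
rewrite hb in h1 h2.
have f1 : (1 - a * l) * (1 + r ^+ 2) <= 2 * r.
  rewrite -(ler_pM2r r0); lra.
have f2 : (a * L - 1) * (1 + r ^+ 2) <= 2 * r.
  rewrite -(ler_pM2r r0); lra.
have Ll : 0 < L + l by lra.
have g1 : (1 - a * l) * (L + l) <= L - l.
  rewrite -(ler_pM2r r2); nra.
have g2 : (a * L - 1) * (L + l) <= L - l.
  rewrite -(ler_pM2r r2); nra.
(* The bounds at [l] and at [L] squeeze a(L + l) - 2 from opposite sides. *)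
have k1 : 0 <= l * (a * (L + l) - 2) by lra.
have k2 : L * (a * (L + l) - 2) <= 0 by lra.
rewrite pmulr_rge0 // in k1; rewrite pmulr_rle0 // in k2; last lra.
apply: (mulIf (lt0r_neq0 Ll)); rewrite divfK ?lt0r_neq0 //; lra.
Qed.

(** The bound on |s| says that (r - z1)(r - z2) and (r + z1)(r + z2), equal to r^2 + b - sr and r^2
    + b + sr, are nonnegative. For real roots each is a product of nonnegative factors; for
    conjugate roots each is a squared modulus. *)
Lemma quadratic_roots_bound (R : rcfType) (z1 z2 : R[i]) (s b r : R) :
  z1 + z2 = s%:C%C -> z1 * z2 = b%:C%C ->
  ComplexField.Normc.normc z1 <= r -> ComplexField.Normc.normc z2 <= r ->
  `|b| <= r ^+ 2 /\ `|s| * r <= r ^+ 2 + b.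
Proof.
case: z1 z2 => [x1 y1] [x2 y2] [] <- e1 [] <- e2 h1 h2.
have r0 : 0 <= r by apply: le_trans h1; rewrite sqrtr_ge0.
have k1 : x1 ^+ 2 + y1 ^+ 2 <= r ^+ 2.
  by rewrite -ler_sqrt ?exprn_ge0 // sqrtr_sqr ger0_norm.
have k2 : x2 ^+ 2 + y2 ^+ 2 <= r ^+ 2.
  by rewrite -ler_sqrt ?exprn_ge0 // sqrtr_sqr ger0_norm.
have ey : y2 = - y1 by lra.
subst y2.
split; first by rewrite ler_norml; apply/andP; split; nra.
(* The imaginary part of the product vanishes: the roots are real or conjugate. *)
have : y1 * (x2 - x1) = 0 by lra.
move/eqP; rewrite mulf_eq0 => /orP[/eqP y0|/eqP x12].
  subst y1.
  have m1 : `|x1| <= r.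
    by rewrite -(ler_pXn2r (n := 2)) ?nnegrE // real_normK ?num_real; lra.
  have m2 : `|x2| <= r.
    by rewrite -(ler_pXn2r (n := 2)) ?nnegrE // real_normK ?num_real; lra.
  move: m1 m2; rewrite !ler_norml => /andP[? ?] /andP[? ?].
  have p1 : 0 <= (r - x1) * (r - x2) by apply: mulr_ge0; lra.
  have p2 : 0 <= (r + x1) * (r + x2) by apply: mulr_ge0; lra.
  by case: (ger0P (x1 + x2)) => _; lra.
have -> : x2 = x1 by lra.
case: (ger0P (x1 + x1)) => ?.
  by have := sqr_ge0 (r - x1); have := sqr_ge0 y1; lra.
by have := sqr_ge0 (r + x1); have := sqr_ge0 y1; lra.
Qed.

(** With nonpositive discriminant the two roots are conjugate or coincide, and their product is
    [b]. *)
Lemma normc_quadratic_root (R : rcfType) (z : R[i]) (s b : R) :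
  s ^+ 2 <= 4 * b -> z ^+ 2 - s%:C%C * z + b%:C%C = 0 ->
  ComplexField.Normc.normc z = Num.sqrt b.
Proof.
case: z => x y hd [] /= e1 e2; congr Num.sqrt.
(* This is the imaginary part of the equation. If y = 0, the real part reads (2x - s)^2 = s^2 - 4b,
   so x = s/2 in both cases. *)
have : y * (2 * x - s) = 0 by lra.
move/eqP; rewrite mulf_eq0 => /orP[/eqP y0|/eqP hx].
  subst y.
  have : (2 * x - s) ^+ 2 <= 0 by nra.
  move=> h; have /eqP : (2 * x - s) ^+ 2 = 0 by apply/eqP; rewrite eq_le h sqr_ge0.
  by rewrite sqrf_eq0 => /eqP; nra.
nra.
Qed.

(** * Ranks, determinants and diagonalisation *)

Lemma rank_diag_mx (F : fieldType) (n : nat) (d : 'rV[F]_n) :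
  \rank (diag_mx d) = (\sum_i (d 0%R i != 0%R))%N.
Proof.
elim: n d => [|n IHn] d; first by rewrite big_ord0 thinmx0 mxrank0.
have [a [e ->]] : exists (a : 'rV[F]_1) (e : 'rV[F]_n), d = row_mx a e.
  (* Row vectors of size [n.+1] and [1 + n] have convertible types, which lets the first entry be
     split off as a block. *)
  by exists (@lsubmx _ 1 1 n d), (@rsubmx _ 1 1 n d); rewrite hsubmxK.
transitivity (\rank (block_mx (diag_mx a) 0 0 (diag_mx e))).
  by rewrite -diag_mx_row.
rewrite rank_diag_block_mx IHn.
rewrite (@big_split_ord _ _ _ 1 n) big_ord1 /=; congr (_ + _)%N.
  rewrite (_ : diag_mx a = a); last first.
    by apply/matrixP => i j; rewrite !ord1 !mxE eqxx.
  rewrite rank_rV; transitivity (nat_of_bool (a 0 0 != 0)%R).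
    congr (nat_of_bool (~~ _)); apply/eqP/eqP => [->|h]; first by rewrite mxE.
    by apply/matrixP => i j; rewrite !ord1 h mxE.
  exact: (congr1 (fun x : F => nat_of_bool (x != 0%R)) (esym (row_mxEl a e 0 0))).
apply: eq_bigr => i _.
exact: (congr1 (fun x : F => nat_of_bool (x != 0%R)) (esym (row_mxEr a e 0 i))).
Qed.

Lemma rank_kermx_diagonalized (F : fieldType) (n : nat) (A P : 'M[F]_n) (d : 'rV[F]_n) :
  P \in unitmx -> A = invmx P *m diag_mx d *m P ->
  \rank (kermx A) = (\sum_i (d 0%R i == 0%R))%N.
Proof.
move=> Pu ->; rewrite mxrank_ker mxrankMfree ?row_free_unit //.
rewrite (eqmxMfull) ?row_full_unit ?unitmx_inv // rank_diag_mx.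
apply/eqP; rewrite -(eqn_add2r (\sum_i (d 0%R i != 0%R))%N) subnK; last first.
  by rewrite -[leqRHS]card_ord -sum1_card leq_sum // => i _; apply: leq_b1.
rewrite -big_split /= -{1}[n]card_ord -sum1_card; apply/eqP/eq_bigr => i _.
by case: eqP.
Qed.

(** Polynomial coefficients [p] and [q] let one formula serve both the characteristic polynomial of
    [A] and the quadratic pencil coming from the system matrix. *)
Lemma det_linear_pencil (F : fieldType) (n : nat) (A P : 'M[F]_n) (d : 'rV[F]_n)
    (p q : {poly F}) :
  P \in unitmx -> A = invmx P *m diag_mx d *m P ->
  \det (p%:M + q *: map_mx polyC A) = \prod_i (p + q * (d 0%R i)%:P).
Proof.
move=> Pu eA.
have PK : map_mx polyC (invmx P) *m map_mx polyC P = 1%:M.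
  by rewrite -map_mxM mulVmx // map_mx1.
have -> : p%:M + q *: map_mx polyC A =
    map_mx polyC (invmx P) *m diag_mx (\row_i (p + q * (d 0%R i)%:P)) *m map_mx polyC P.
  have -> : diag_mx (\row_i (p + q * (d 0%R i)%:P)) =
      p%:M + q *: map_mx polyC (diag_mx d).
    apply/matrixP => i j; rewrite !mxE; case: (i == j); rewrite ?mulr1n ?mulr0n //.
    by rewrite polyC0 mulr0 addr0.
  rewrite mulmxDr mulmxDl -scalemxAr -scalemxAl -!map_mxM -eA; congr (_ + _).
  by rewrite -mulmxA mul_scalar_mx -scalemxAr PK scalemx1.
rewrite !det_mulmx mulrAC -det_mulmx PK det1 mul1r det_diag.
by apply: eq_bigr => i _; rewrite mxE.
Qed.

Lemma char_poly_diagonalized (F : fieldType) (n : nat) (A P : 'M[F]_n) (d : 'rV[F]_n) :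
  P \in unitmx -> A = invmx P *m diag_mx d *m P ->
  char_poly A = \prod_i ('X - (d 0%R i)%:P).
Proof.
move=> Pu eA; rewrite /char_poly /char_poly_mx -scaleN1r.
rewrite (det_linear_pencil _ _ _ _ _ _ (-1) Pu eA).
by apply: eq_bigr => i _; rewrite mulN1r.
Qed.

Lemma char_poly_companion (F : fieldType) (n : nat) (A : 'M[F]_n) (b : F) :
  char_poly (block_mx A (- b%:M) 1%:M 0) =
  \det (('X ^+ 2 + b%:P)%:M - 'X *: map_mx polyC A).
Proof.
(* Right multiplication by [M] clears the lower left block of the characteristic matrix and leaves
   ['X] as lower right block; the factor ['X^n] then cancels against [\det M]. *)
pose M : 'M[{poly F}]_(n + n) := block_mx 'X%:M 0 1%:M 1%:M.
have detM : \det M = 'X ^+ n by rewrite det_lblock det_scalar det1 mulr1.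
have X0 : 'X^n != 0 :> {poly F} by rewrite expf_neq0 ?polyX_eq0.
apply: (mulIf X0).
rewrite -{1}detM -det_mulmx /char_poly_mx map_block_mx map_mxN !map_scalar_mx map_mx0.
rewrite scalar_mx_block opp_block_mx add_block_mx mulmx_block.
rewrite !mulmx1 !mulmx0 !add0r subr0 opprK rmorph1 !mulNmx mul1mx addNr.
rewrite det_ublock det_scalar; congr (\det _ * _).
rewrite mulmxBl -scalar_mxM -mul_mx_scalar addrAC; congr (_ + _).
by rewrite -raddfD /= expr2.
Qed.

(** The spectral theorem for Hermitian matrices is applied over [R[i]]. A complex [P] suffices
    because only the spectrum with multiplicities is used later; the diagonal is real and is
    returned over [R]. *)
Lemma symmetric_diagonalizable (R : rcfType) (n : nat) (A : 'M[R]_n) :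
  A^T = A ->
  exists (P : 'M[R[i]]_n) (d : 'rV[R]_n), P \in unitmx /\
    map_mx (real_complex R) A =
      invmx P *m diag_mx (map_mx (real_complex R) d) *m P.
Proof.
move=> Asym; set B := map_mx _ A.
have Breal : B \is a mxOver Num.real.
  by apply/mxOverP => i j; rewrite mxE; apply/complex_realP; exists (A i j).
have Bsym : B \is symmetricmx.
  apply/is_hermitianmxP; rewrite expr0 scale1r /B map_trmx Asym.
  by apply/matrixP => i j; rewrite !mxE.
have Bherm := realsym_hermsym Bsym Breal.
have /orthomx_spectralP eB := hermitian_normalmx Bherm.
have /mxOverP dreal := hermitian_spectral_diag_real Bherm.
exists (spectralmx B), (\row_i complex.Re (spectral_diag B 0 i)).
split; first exact: spectral_unit.
rewrite [LHS]eB; congr (_ *m diag_mx _ *m _).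
by apply/rowP => i; rewrite !mxE RRe_real.
Qed.

(** * The list of eigenvalues of the system matrix *)

Lemma perm_iter_rem (T : eqType) (x : T) (k : nat) (s t : seq T) :
  perm_eq s (nseq k x ++ t) -> perm_eq (iter k (rem x) s) t.
Proof.
elim: k s => [//|k IHk] s h; rewrite iterSr; apply: IHk.
have xs : x \in s by rewrite (perm_mem h) mem_head.
by rewrite -(perm_cons x) -(permPl (perm_to_rem xs)).
Qed.

Lemma roots_of_sum_prod (C : numClosedFieldType) (s b : C) :
  exists z : C * C, z.1 + z.2 = s /\ z.1 * z.2 = b.
Proof.
pose w := sqrtC (s ^+ 2 - 4 * b).
have hw : w ^+ 2 = s ^+ 2 - 4 * b by rewrite sqrtCK.
exists ((s + w) / 2, (s - w) / 2) => /=; split; first by field.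
rewrite (_ : _ * _ = (s ^+ 2 - w ^+ 2) / 4); last by field.
by rewrite hw; field.
Qed.

Lemma eigenvalues_prod (R : realType) (m : nat) (A : 'M[R]_m) :
  \prod_(z <- eigenvalues A) ('X - z%:P) = char_poly (map_mx (real_complex R) A).
Proof.
rewrite /eigenvalues; case: closed_field_poly_normal => r /= e.
by rewrite [RHS]e (monicP (char_poly_monic _)) scale1r.
Qed.

(** The copies of 1 due to the kernel are put in front, in the form that [perm_iter_rem] strips. A
    further 1 arising from [b] or from a nonzero eigenvalue stays in the list. *)
Lemma perm_eigenvalues_system (R : realType) (n : nat) (A : 'M[R]_n)
    (P : 'M[R[i]]_n) (d : 'rV[R]_n) (a b : R) :
  P \in unitmx ->
  map_mx (real_complex R) A =
    invmx P *m diag_mx (map_mx (real_complex R) d) *m P ->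
  exists z : 'I_n -> R[i] * R[i],
    (forall i, (z i).1 + (z i).2 = ((1 + b) * (1 - a * d 0 i))%:C%C /\
               (z i).1 * (z i).2 = b%:C%C) /\
    perm_eq
      (eigenvalues (block_mx ((1 + b) *: (1%:M - a *: A)) (- b%:M) 1%:M 0))
      (nseq (\rank (kermx A)) 1 ++ nseq (\rank (kermx A)) b%:C%C ++
       flatten [seq [:: (z i).1; (z i).2] | i <- enum 'I_n & d 0 i != 0]).
Proof.
move=> Pu eA.
have /choice[z zP] : forall i : 'I_n, exists z : R[i] * R[i],
    z.1 + z.2 = ((1 + b) * (1 - a * d 0 i))%:C%C /\ z.1 * z.2 = b%:C%C.
  by move=> i; apply: roots_of_sum_prod.
(* Two lists with the same product of linear factors are permutations of each other. *)
exists z; split => //; apply: prod_XsubC_eq; rewrite eigenvalues_prod.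
rewrite map_block_mx map_mxN !map_scalar_mx map_mx0 /= rmorph1 char_poly_companion.
set c := ((1 + b)%:C)%C; set e := ((1 + b) * a)%:C%C.
(* The determinant is regrouped as a linear pencil in [A], to which [det_linear_pencil] applies. *)
have -> : ('X ^+ 2 + (b%:C)%C%:P)%:M -
    'X *: map_mx polyC (map_mx (real_complex R) ((1 + b) *: (1%:M - a *: A))) =
   ('X ^+ 2 + (b%:C)%C%:P - c%:P * 'X)%:M +
   (e%:P * 'X) *: map_mx polyC (map_mx (real_complex R) A).
  apply/matrixP => i j; rewrite !mxE /c /e; case: (i == j); rewrite ?mulr1n ?mulr0n;
    rewrite !(rmorphM, rmorphB, rmorphD, rmorph1, rmorph0) /=; ring.
rewrite (det_linear_pencil _ _ _ _ _ _ _ Pu eA).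
have fac i : 'X ^+ 2 + (b%:C)%C%:P - c%:P * 'X +
      e%:P * 'X * (map_mx (real_complex R) d 0 i)%:P
    = ('X - ((z i).1)%:P) * ('X - ((z i).2)%:P).
  have [zs zp] := zP i.
  rewrite mxE /= -zp.
  transitivity ('X ^+ 2 + ((z i).1 * (z i).2)%:P -
    ((z i).1 + (z i).2)%:P * 'X : {poly R[i]}).
    rewrite zs /c /e !(rmorphM, rmorphB, rmorphD, rmorph1, rmorph0) /=; ring.
  rewrite !(rmorphM, rmorphD) /=; ring.
rewrite !big_cat /= big_flatten /= big_map big_filter big_enum_cond /=.
rewrite (bigID (fun i => d 0 i == 0)) /= mulrA; congr (_ * _); last first.
  by apply: eq_bigr => i _; rewrite !big_cons big_nil mulr1 fac.
rewrite !big_nseq !iter_mulr_1 -exprMn.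
rewrite (eq_bigr (fun _ => ('X - 1%:P) * ('X - b%:C%C%:P))); last first.
  move=> i /eqP di0; rewrite mxE di0 /c rmorph0.
  rewrite !(rmorphM, rmorphB, rmorphD, rmorph1, rmorph0) /=; ring.
rewrite prodr_const; congr (_ ^+ _).
(* The kernel keeps its dimension over [R[i]], where it is the number of zero diagonal entries. *)
rewrite -(mxrank_map (real_complex R)) map_kermx.
rewrite (rank_kermx_diagonalized _ _ _ _ _ Pu eA).
rewrite -sum1_card big_mkcond; apply: eq_bigr => i _.
by rewrite [in RHS]mxE fmorph_eq0 unfold_in -[hasDecEq.eq_op _ _ _]/(d 0 i == 0);
  case: (d 0 i == 0).
Qed.

(** * Differentials of the gradient, of the descent map and of the system map *)

Lemma is_diff_mulmxr (R : realType) (m n : nat) (J : 'M[R]_(m, n)) (x : 'rV[R]_m) :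
  is_diff x (fun v : 'rV[R]_m => v *m J) (fun v => v *m J).
Proof.
pose g := mulmxr J : {linear 'rV[R]_m -> 'rV[R]_n}.
have gd y : differentiable g y.
  have -> : (g : _ -> _) = \sum_(i < m) (fun v : 'rV[R]_m => v 0 i *: row i J).
    by apply/funext => v /=; rewrite fct_sumE mulmx_sum_row.
  apply: differentiable_sum => i; apply: differentiableZl.
  exact: differentiable_coord.
(* A linear map is its own differential once it is continuous; continuity is read off from the
   expansion into coordinates times fixed rows. *)
have gc : continuous g by move=> y; apply: differentiable_continuous.
apply: DiffDef; first exact: gd.
by apply: (@diff_lin _ _ _ g).
Qed.

Lemma jacobian_is_diff (R : realType) (m n : nat) (f : 'rV[R]_m -> 'rV[R]_n)
    (x : 'rV[R]_m) (J : 'M[R]_(m, n)) :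
  is_diff x f (fun v => v *m J) -> jacobian f x = J.
Proof.
move=> df; apply/row_matrixP => i; rewrite !rowE /jacobian mul_rV_lin1 /=.
by rewrite diff_val.
Qed.

(** Row i of [hessian f x] is the derivative of [grad f] along the i-th basis vector, which is
    exactly the matrix acting on row vectors from the right. *)
Lemma is_diff_grad (R : realType) (n : nat) (f : 'rV[R]_n -> R) (x : 'rV[R]_n) :
  differentiable (grad f) x ->
  is_diff x (grad f) (fun v => v *m hessian f x).
Proof.
move=> dg; apply: DiffDef => //; apply/funext => v.
have -> : hessian f x = jacobian (grad f) x.
  apply/row_matrixP => i; rewrite !rowE -[in RHS]deriveEjacobian //.
  rewrite derive_mx; last exact: diff_derivable.
  apply/rowP => j; rewrite -rowE [LHS]mxE [LHS]mxE [RHS]mxE.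
  have -> : (fun y => grad f y 0 j) = (fun y => 'D_(delta_mx 0 j) f y).
    by apply/funext => y; rewrite mxE.
  by [].
by rewrite /jacobian mul_rV_lin1.
Qed.

Lemma is_diff_sd_map (R : realType) (n : nat) (f : 'rV[R]_n -> R) (x : 'rV[R]_n)
    (a : R) :
  differentiable (grad f) x ->
  is_diff x (sd_map f a) (fun v => v *m (1%:M - a *: hessian f x)).
Proof.
move=> dg; have dg' := is_diff_grad _ _ _ _ dg.
apply: (@is_diff_eq _ _ _ _ (id - a *: (fun v => v *m hessian f x))).
by apply/funext => v; rewrite mulmxBr mulmx1 -scalemxAr.
Qed.

Lemma is_diff_system_map (R : realType) (n : nat) (f : 'rV[R]_n -> R)
    (x : 'rV[R]_n) (a b : R) :
  differentiable (grad f) x ->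
  is_diff (row_mx x x) (system_map f a b)
    (fun v => v *m (TN f x a b)^T).
Proof.
move=> dg; have ds := is_diff_sd_map _ _ _ _ a dg.
(* Projections onto the two halves ([PL], [PR]) and injections of them ([EL], [ER]) are written as
   matrix products, so that the system map becomes a sum of composites covered by the
   differentiation rules. *)
pose PL : 'M[R]_(n + n, n) := col_mx 1%:M 0.
pose PR : 'M[R]_(n + n, n) := col_mx 0 1%:M.
pose EL : 'M[R]_(n, n + n) := row_mx 1%:M 0.
pose ER : 'M[R]_(n, n + n) := row_mx 0 1%:M.
have PLE (z : 'rV[R]_(n + n)) : z *m PL = lsubmx z.
  by rewrite -{1}[z]hsubmxK mul_row_col mulmx1 mulmx0 addr0.
have PRE (z : 'rV[R]_(n + n)) : z *m PR = rsubmx z.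
  by rewrite -{1}[z]hsubmxK mul_row_col mulmx1 mulmx0 add0r.
have E (u w : 'rV[R]_n) : u *m EL + w *m ER = row_mx u w.
  by rewrite !mul_mx_row !mulmx1 !mulmx0 add_row_mx addr0 add0r.
have dPL := is_diff_mulmxr _ _ _ PL (row_mx x x).
have dPR := is_diff_mulmxr _ _ _ PR (row_mx x x).
have dEL := is_diff_mulmxr _ _ _ EL.
have dER := is_diff_mulmxr _ _ _ ER.
have ds' : is_diff (row_mx x x *m PL) (sd_map f a)
    (fun v => v *m (1%:M - a *: hessian f x)) by rewrite PLE row_mxKl.
have ds1 := is_diff_comp dPL ds'.
have du := is_diffB (is_diffZ (1 + b) ds1) (is_diffZ b dPR).
have dt := is_diffD (is_diff_comp du (dEL _)) (is_diff_comp dPL (dER _)).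
have -> : system_map f a b = ((fun u => u *m EL) \o
    ((1 + b) *: (sd_map f a \o (fun z => z *m PL)) - b *: (fun z => z *m PR))) +
    ((fun u => u *m ER) \o (fun z => z *m PL)).
  by apply/funext => z; rewrite [RHS]E /system_map -PLE -PRE.
apply: (is_diff_eq dt); apply/funext => v; rewrite [LHS]E /=.
rewrite /TN /jac (jacobian_is_diff _ _ _ _ _ _ ds).
rewrite tr_block_mx [(_ *: _)^T]linearZ /= trmxK.
rewrite -[v in RHS]hsubmxK mul_row_block trmx1 trmx0 [(- _)^T]linearN /=.
rewrite tr_scalar_mx !mulmx1 mulmx0 addr0.
by rewrite -scalemxAr mulmxN mul_mx_scalar -PLE -PRE.
Qed.

(** * Bounding the spectral radius through the eigenvalues of the Hessian *)

Lemma eigenvalue_diagonalized (R : rcfType) (n : nat) (A : 'M[R]_n)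
    (P : 'M[R[i]]_n) (d : 'rV[R]_n) (mu : R) :
  P \in unitmx ->
  map_mx (real_complex R) A =
    invmx P *m diag_mx (map_mx (real_complex R) d) *m P ->
  eigenvalue A mu <-> exists i, d 0 i = mu.
Proof.
move=> Pu eA; rewrite eigenvalue_root_char -(fmorph_root (real_complex R)) map_char_poly.
rewrite (char_poly_diagonalized _ _ _ _ _ Pu eA) /root horner_prod prodf_seq_eq0.
split=> [/hasP[i _]|[i di]].
  rewrite mxE hornerXsubC -rmorphB fmorph_eq0 subr_eq0 => /eqP ->.
  by exists i.
apply/hasP; exists i; first exact: mem_index_enum.
by rewrite /= [map_mx _ _ _ _]mxE hornerXsubC -di subrr.
Qed.

(** The pair attached to a nonzero eigenvalue survives the deletion of the kernel's ones, so the
    radius dominates both moduli. *)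
Lemma system_root_pair (R : realType) (n : nat) (A : 'M[R]_n) (a b mu : R) :
  A^T = A -> eigenvalue A mu -> mu != 0 ->
  let rho := spectral_radius_without_ones (\rank (kermx A))
      (block_mx ((1 + b) *: (1%:M - a *: A)) (- b%:M) 1%:M 0) in
  exists z1 z2 : R[i],
    [/\ z1 + z2 = ((1 + b) * (1 - a * mu))%:C%C, z1 * z2 = b%:C%C,
        ComplexField.Normc.normc z1 <= rho & ComplexField.Normc.normc z2 <= rho].
Proof.
move=> Asym Amu mu0 rho; have [P [d [Pu eA]]] := symmetric_diagonalizable _ _ _ Asym.
have [i di] := (eigenvalue_diagonalized _ _ _ _ _ mu Pu eA).1 Amu.
have [z [zP zperm]] := perm_eigenvalues_system _ _ _ _ _ a b Pu eA.
have [zs zp] := zP i; rewrite di in zs.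
have zrho x : x \in [:: (z i).1; (z i).2] -> ComplexField.Normc.normc x <= rho.
  move=> xz; apply: (le_bigmax_seq _ x xpredT) => //.
  rewrite (perm_mem (perm_iter_rem _ _ _ _ _ zperm)) mem_cat; apply/orP; right.
  apply/flattenP; exists [:: (z i).1; (z i).2] => //; apply/mapP; exists i => //.
  by rewrite mem_filter mem_enum di mu0.
by exists (z i).1, (z i).2; split => //; apply: zrho; rewrite !inE eqxx ?orbT.
Qed.

(** The surviving list consists of copies of [b] from the kernel and of the root pairs; 0 <= r
    covers the starting value 0 of the maximum. *)
Lemma system_radius_le (R : realType) (n : nat) (A : 'M[R]_n) (a b r : R) :
  A^T = A -> 0 <= r -> `|b| <= r ->
  (forall (mu : R) (z : R[i]), eigenvalue A mu -> mu != 0 ->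
     z ^+ 2 - ((1 + b) * (1 - a * mu))%:C%C * z + b%:C%C = 0 ->
     ComplexField.Normc.normc z <= r) ->
  spectral_radius_without_ones (\rank (kermx A))
      (block_mx ((1 + b) *: (1%:M - a *: A)) (- b%:M) 1%:M 0) <= r.
Proof.
move=> Asym r0 br hr; have [P [d [Pu eA]]] := symmetric_diagonalizable _ _ _ Asym.
have [z [zP zperm]] := perm_eigenvalues_system _ _ _ _ _ a b Pu eA.
rewrite /spectral_radius_without_ones big_seq; apply: bigmax_le => // x.
rewrite (perm_mem (perm_iter_rem _ _ _ _ _ zperm)) mem_cat => /orP[|].
  by rewrite mem_nseq => /andP[_ /eqP ->] /=; rewrite expr0n addr0 sqrtr_sqr.
move=> /flattenP[_ /mapP[i + ->] xz]; rewrite mem_filter => /andP[di0 _].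
have [zs zp] := zP i.
apply: (hr (d 0 i)) => //.
  by apply/(eigenvalue_diagonalized _ _ _ _ _ _ Pu eA); exists i.
by rewrite -zs -zp; move: xz; rewrite !inE => /orP[] /eqP ->; ring.
Qed.

(** * Identities and bounds for the optimal rate *)

Definition optimal_rate (R : rcfType) (L l : R) : R :=
  (Num.sqrt (L / l) - 1) / (Num.sqrt (L / l) + 1).

Arguments optimal_rate {R}.

Lemma sqrt_ratio_gt1 (R : rcfType) (l L : R) :
  0 < l -> l < L -> 1 < Num.sqrt (L / l).
Proof.
move=> l0 lL.
have q1 : 1 < L / l by rewrite ltr_pdivlMr // mul1r.
by rewrite -{1}sqrtr1 ltr_sqrt //; lra.
Qed.

Lemma sqrt_ratio_sqr (R : rcfType) (l L : R) :
  0 < l -> l < L -> L = Num.sqrt (L / l) ^+ 2 * l.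
Proof. by move=> l0 lL; rewrite sqr_sqrtr ?divr_ge0 ?divfK ?lt0r_neq0 //; lra. Qed.

Lemma rate_bounds (R : rcfType) (l L : R) :
  0 < l -> l < L -> 0 < optimal_rate L l /\ optimal_rate L l < 1.
Proof.
move=> l0 lL.
have s1 := sqrt_ratio_gt1 _ _ _ l0 lL.
rewrite /optimal_rate; split; first by rewrite divr_gt0 //; lra.
rewrite ltr_pdivrMr; lra.
Qed.

(** This is (L - l)/(L + l) = 2r/(1 + r^2) without denominators; substituting L = s^2 l with s =
    sqrt(L/l) makes it a rational identity in s and l. *)
Lemma rate_rho_q (R : rcfType) (l L : R) :
  0 < l -> l < L ->
  2 * optimal_rate L l * (L + l) = (1 + optimal_rate L l ^+ 2) * (L - l).
Proof.
move=> l0 lL.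
have s0 := sqrtr_ge0 (L / l).
have s2 := sqrt_ratio_sqr _ _ _ l0 lL.
rewrite /optimal_rate; set s := Num.sqrt (L / l) in s0 s2 *.
rewrite [in LHS]s2 [in RHS]s2.
by field; lra.
Qed.

(** Since (L - l)/(L + l) = 2r/(1 + r^2), the number under the root is the square of (1 - r^2)/(1 +
    r^2). *)
Lemma optimal_beta (R : rcfType) (l L : R) : 0 < l -> l < L ->
  (1 - Num.sqrt (1 - ((L - l) / (L + l)) ^+ 2)) /
  (1 + Num.sqrt (1 - ((L - l) / (L + l)) ^+ 2)) = optimal_rate L l ^+ 2.
Proof.
move=> l0 lL.
have [r0 r1] := rate_bounds _ _ _ l0 lL; have e := rate_rho_q _ _ _ l0 lL.
set r := optimal_rate L l in r0 r1 e *.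
have r2 : r ^+ 2 < 1 by rewrite expr_lt1 // ltW.
have r2p := sqr_ge0 r.
have -> : (L - l) / (L + l) = 2 * r / (1 + r ^+ 2).
  apply/eqP; rewrite eqr_div; [|by lra|by lra].
  by rewrite e mulrC.
have -> : 1 - (2 * r / (1 + r ^+ 2)) ^+ 2 = ((1 - r ^+ 2) / (1 + r ^+ 2)) ^+ 2.
  by field; lra.
rewrite sqrtr_sqr ger0_norm ?divr_ge0 //; try lra.
by field; lra.
Qed.

(** In terms of s = sqrt(L/l) the claim is 2/sqrt(3s^2 + 1) < 2/(s + 1), that is 2s(s - 1) > 0. *)
Lemma rate_lt (R : rcfType) (l L : R) :
  0 < l -> l < L -> optimal_rate L l < 1 - Num.sqrt (4 * l / (3 * L + l)).
Proof.
move=> l0 lL.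
have s1 := sqrt_ratio_gt1 _ _ _ l0 lL.
have s2 := sqrt_ratio_sqr _ _ _ l0 lL.
rewrite /optimal_rate; set s := Num.sqrt (L / l) in s1 s2 *.
have -> : (s - 1) / (s + 1) = 1 - 2 / (s + 1) by field; lra.
rewrite ltrD2l ltrN2 -[ltRHS]ger0_norm ?divr_ge0 //; try lra.
rewrite -sqrtr_sqr ltr_sqrt; last by rewrite exprn_gt0 // divr_gt0 //; lra.
have -> : 4 * l / (3 * L + l) = 4 / (3 * s ^+ 2 + 1).
  by rewrite s2; field; apply/andP; split; nra.
rewrite expr_div_n ltr_pdivrMr; last nra.
rewrite mulrAC ltr_pdivlMr; last by rewrite exprn_gt0; lra.
nra.
Qed.

(** * Optimality and uniqueness of the parameters *)

(** Assuming only an inequality yields both uniqueness and the lower bound: a smaller radius would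
    already force the optimal parameters. Only the quadratics at [l] and [L] are needed. *)
Lemma radius_le_unique (R : realType) (n : nat) (A : 'M[R]_n) (L l : R) (a b : R) :
  A^T = A -> largest_eigenvalue A L -> smallest_nonzero_eigenvalue A l ->
  0 < l -> l < L ->
  spectral_radius_without_ones (\rank (kermx A))
    (block_mx ((1 + b) *: (1%:M - a *: A)) (- b%:M) 1%:M 0) <= optimal_rate L l ->
  a = 2 / (L + l) /\ b = optimal_rate L l ^+ 2.
Proof.
move=> Asym L_max l_min l0 lL le_r; have [r0 r1] := rate_bounds _ _ _ l0 lL.
have bnd mu : eigenvalue A mu -> mu != 0 ->
    `|b| <= optimal_rate L l ^+ 2 /\
    `|(1 + b) * (1 - a * mu)| * optimal_rate L l <= optimal_rate L l ^+ 2 + b.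
  move=> Amu mu0.
  have [z1 [z2 [zs zp h1 h2]]] := system_root_pair _ _ _ a b _ Asym Amu mu0.
  by apply: (quadratic_roots_bound _ z1 z2) => //; apply: (le_trans _ le_r).
have [Al lneq0 _] := l_min; have [AL _] := L_max.
have [br hl] := bnd l Al lneq0.
have [_ hL] := bnd L AL (lt0r_neq0 (lt_trans l0 lL)).
exact: (optimal_parameters_unique _ l L) (rate_rho_q _ _ _ l0 lL) br hl hL.
Qed.

Lemma radius_optimal (R : realType) (n : nat) (A : 'M[R]_n) (L l : R) :
  A^T = A -> largest_eigenvalue A L -> smallest_nonzero_eigenvalue A l ->
  0 < l -> l < L ->
  spectral_radius_without_ones (\rank (kermx A))
    (block_mx ((1 + optimal_rate L l ^+ 2) *: (1%:M - 2 / (L + l) *: A))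
       (- (optimal_rate L l ^+ 2)%:M) 1%:M 0) =
  optimal_rate L l.
Proof.
move=> Asym L_max l_min l0 lL; set r := optimal_rate L l.
have [r0 r1] := rate_bounds _ _ _ l0 lL; have e := rate_rho_q _ _ _ l0 lL.
rewrite -/r in r0 r1 e.
have [Al lneq0 l_le] := l_min; have [AL L_ge] := L_max.
apply/eqP; rewrite eq_le; apply/andP; split; last first.
  (* Lower bound: two roots with product r^2 cannot both have modulus below r. *)
  have [z1 [z2 [zs zp h1 h2]]] :=
    system_root_pair _ _ _ (2 / (L + l)) (r ^+ 2) _ Asym Al lneq0.
  have [+ _] := quadratic_roots_bound _ _ _ _ _ _ zs zp h1 h2.
  rewrite ger0_norm ?sqr_ge0 // ler_pXn2r // nnegrE ?(ltW r0) //.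
  by apply: (le_trans _ h1); case: (z1) => x y; apply: sqrtr_ge0.
apply: system_radius_le => //; first exact: ltW.
  by rewrite ger0_norm ?sqr_ge0 // expr2 ger_pMr // ltW.
move=> mu z Amu mu0 hz; rewrite (normc_quadratic_root _ _ _ _ _ hz).
  by rewrite sqrtr_sqr ger0_norm // ltW.
have lmu := l_le _ Amu mu0; have muL := L_ge _ Amu.
have Ll : 0 < L + l by lra.
(* For mu in [l, L] one has |L + l - 2 mu| <= L - l; by [e] this is the nonpositivity of the
   discriminant, with equality at both ends. *)
have k : `|(1 + r ^+ 2) * (1 - 2 / (L + l) * mu)| <= 2 * r.
  have r2 := sqr_ge0 r.
  rewrite -(ler_pM2r Ll) e normrM ger0_norm; last lra.
  rewrite -[X in X <= _]mulrA ler_pM2l; last lra.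
  rewrite -[X in _ * X](ger0_norm (ltW Ll)) -normrM.
  have -> : (1 - 2 / (L + l) * mu) * (L + l) = L + l - 2 * mu.
    by field; rewrite lt0r_neq0.
  by rewrite ler_norml; lra.
rewrite -real_normK ?num_real // (_ : 4 * r ^+ 2 = (2 * r) ^+ 2); last by ring.
by rewrite ler_pXn2r // nnegrE ?normr_ge0 //; lra.
Qed.

Theorem theorem4p1 (R : realType) (n : nat) (f : 'rV[R]_n -> R)
    (xs : 'rV[R]_n) (L l : R)
    (f_C2 : twice_continuously_differentiable f)
    (grad_xs : grad f xs = 0)
    (H_psd : psd (hessian f xs))
    (L_max : largest_eigenvalue (hessian f xs) L)
    (l_min : smallest_nonzero_eigenvalue (hessian f xs) l)
    (l_gt0 : 0 < l) (l_lt_L : l < L) :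
  let kappa := L / l in
  let rho_q := (L - l) / (L + l) in
  let rho_opt := (Num.sqrt kappa - 1) / (Num.sqrt kappa + 1) in
  let alphaN := 2 / (L + l) in
  let betaN := (1 - Num.sqrt (1 - rho_q ^+ 2)) / (1 + Num.sqrt (1 - rho_q ^+ 2)) in
  (* q'(x^* ) = I - alpha H, and T_N is the Jacobian matrix of the system *)
  (forall alpha : R, 0 < alpha ->
     jac (sd_map f alpha) xs = 1%:M - alpha *: hessian f xs) /\
  (forall alpha beta : R, 0 < alpha ->
     differentiable (system_map f alpha beta) (row_mx xs xs) /\
     jac (system_map f alpha beta) (row_mx xs xs) = TN f xs alpha beta) /\
  (* the minimum of rho is rho_opt, attained at (alphaN, betaN) and only there *)
  0 < alphaN /\
  rhoN f xs alphaN betaN = rho_opt /\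
  (forall alpha beta : R, 0 < alpha -> rho_opt <= rhoN f xs alpha beta) /\
  (forall alpha beta : R, 0 < alpha -> rhoN f xs alpha beta = rho_opt ->
     alpha = alphaN /\ beta = betaN) /\
  rho_opt < 1 - Num.sqrt (4 * l / (3 * L + l)) /\
  betaN = rho_opt ^+ 2.
Proof.
move=> kappa rho_q rho_opt alphaN betaN.
have [_ dgrad _] := f_C2; have [Hsym _] := H_psd.
have jacE a : jac (sd_map f a) xs = 1%:M - a *: hessian f xs.
  rewrite /jac (jacobian_is_diff _ _ _ _ _ _ (is_diff_sd_map _ _ _ _ a (dgrad xs))).
  by rewrite linearB linearZ /= trmx1 Hsym.
have rhoE a b : rhoN f xs a b =
    spectral_radius_without_ones (\rank (kermx (hessian f xs)))
      (block_mx ((1 + b) *: (1%:M - a *: hessian f xs)) (- b%:M) 1%:M 0).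
  by rewrite /rhoN /TN jacE.
have betaE : betaN = rho_opt ^+ 2 by apply: optimal_beta.
have opt : rhoN f xs alphaN betaN = rho_opt.
  by rewrite rhoE betaE; apply: radius_optimal.
have rho_le_uniq a b : rhoN f xs a b <= rho_opt -> a = alphaN /\ b = betaN.
  by rewrite rhoE betaE; apply: radius_le_unique.
split; first by move=> a _; apply: jacE.
split.
  move=> a b _; have dT := is_diff_system_map _ _ _ _ a b (dgrad xs).
  split; first exact: ex_diff.
  by rewrite /jac (jacobian_is_diff _ _ _ _ _ _ dT) trmxK.
split; first by rewrite divr_gt0 // addr_gt0 // (lt_trans l_gt0).
split=> //; split.
  (* A radius below [rho_opt] would force the optimal parameters, whose radius is [rho_opt]
     itself. *)
  move=> a b _; rewrite leNgt; apply/negP => lt_opt.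
  have [ea eb] := rho_le_uniq a b (ltW lt_opt).
  by move: lt_opt; rewrite ea eb opt ltxx.
split; first by move=> a b _ eq_opt; apply: rho_le_uniq; rewrite eq_opt.
by split=> //; apply: rate_lt.
Qed.
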